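(* Let $n\ge 2$ be an integer and let $A\subseteq\mathbb{F}_{2^{n-1}}\setminus\{0\}$ with $|A|=k\ge 2$ and $r(A)\neq k(k-1)$. Then there exists a subset of $\mathbb{F}_{2^n}\setminus\{0\}$ of size $k+4$ whose $r$-value is $r(A)+24$.
   Context: For a subset $X$ of a finite additive abelian group, the $r$-value $r(X)$ is the number of ordered pairs $(x,y)\in X\times X$ with $x+y\in X$. Only the additive group of $\mathbb{F}_{2^n}$ is used: its elements are written as vectors $[\alpha_1,\dots,\alpha_n]$ with $\alpha_i\in\{0,1\}$ and addition coordinatewise modulo 2. By convention $\mathbb{F}_{2^{n-1}}$ is regarded as the subset of $\mathbb{F}_{2^n}$ consisting of the vectors with first coordinate $\alpha_1=0$. *)

(* Defs.v *)
From mathcomp Require Import all_boot all_order all_algebra.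

Set Implicit Arguments.
Unset Strict Implicit.
Unset Printing Implicit Defensive.

Import GRing.Theory.
Local Open Scope ring_scope.

Definition rval (V : finZmodType) (X : {set V}) : nat :=
  #|[set p : V * V in setX X X | p.1 + p.2 \in X]|.

(* The field with 2^n elements enters only through its additive group, taken to
   be 'rV['F_2]_n.  The field with 2^(n-1) elements is then the set of vectors
   whose first coordinate (index 0) vanishes.  Quantifying over the indices of
   value 0 avoids requiring n to be a syntactic successor; there is exactly one
   such index when 0 < n. *)
Definition F2n_pred (n : nat) : {set 'rV['F_2]_n} :=
  [set x : 'rV['F_2]_n | [forall i : 'I_n, (i == 0 :> nat)%N ==> (x ord0 i == 0)]].

(* Main.v *)
Require Import Defs.
From mathcomp Require Import all_boot all_order all_algebra.

Import GRing.Theory.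
Local Open Scope ring_scope.

(** The graph-theoretic idea: let [T] be a set of vectors outside the hyperplane
    containing [A].  A Schur triple [(x, y, x + y)] of [A :|: T] lies in [A], or
    has two entries in [T] and one in [A] (sums with an odd number of entries in
    [T] are excluded by the first coordinate).  The place of the entry in [A]
    can be any of three, and in characteristic 2 these three cases are
    equinumerous, so [T] adds three times the number of ordered pairs of [T]
    whose sum is in [A] ([rvalU_odd]), that is, six times the number of edges
    that [T] spans in the Cayley graph of [A].

    A set of four vertices spanning exactly four edges is then wanted.  As
    [0 \notin A], the value [k * (k - 1)] is reached exactly when [A] contains
    the sum of any two of its distinct elements; hence there are distinct
    [a, b] in [A] with [a + b \notin A] ([rval_sum_notin]).  The coset
    [T] of [{0, a, b, a + b}] through a vector outside the hyperplane spans the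
    4-cycle with edges in directions [a] and [b], and its diagonals, in
    direction [a + b], are not edges ([card_coset_sums]). *)

Section ElementaryAbelian2.

Variable V : finZmodType.
Hypothesis addvv : forall x : V, x + x = 0.

Lemma addvK (x y : V) : x + (x + y) = y.
Proof. by rewrite addrA addvv add0r. Qed.

Lemma addv_eq0 (x y : V) : (x + y == 0) = (x == y).
Proof. by rewrite -(inj_eq (addrI x)) addvK addr0 eq_sym. Qed.

(** A diagonal pair [(x, x)] has sum [0], which is not in [A].  So [rval A]
    counts off-diagonal pairs only, and it falls short of their number
    [#|A| * (#|A| - 1)] as soon as one of them has its sum outside [A]; were
    there no such pair, the two numbers would agree. *)
Lemma rval_sum_notin (A : {set V}) :
    0 \notin A -> rval A <> (#|A| * (#|A| - 1))%N ->
  exists a b, [/\ a \in A, b \in A, a != b & a + b \notin A].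
Proof.
move=> A0 rA.
case: (boolP [exists a in A, exists b in A, (a != b) && (a + b \notin A)]).
  case/exists_inP=> a aA /exists_inP[b bA /andP[ab abA]].
  by exists a, b.
move/exists_inPn=> closedA; case: rA.
rewrite mulnBr muln1 -cardsX.
have diagA : [set (x, x) | x in A] \subset setX A A.
  by apply/subsetP=> _ /imsetP[x xA ->]; rewrite inE /= xA.
have <- : #|[set (x, x) | x in A]| = #|A| by rewrite card_imset // => x y [].
rewrite -(setIidPr diagA) -cardsD /rval; apply: eq_card => -[x y]; rewrite !inE /=.
case: (boolP (x \in A)) => xA; last by rewrite andbF.
case: (boolP (y \in A)) => yA; last by rewrite /= andbF.
rewrite andbT /=.
have [<-|xy] := eqVneq x y.
  by rewrite addvv (negPf A0) imset_f.
have /exists_inPn/(_ y yA) := closedA x xA; rewrite xy negbK => ->.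
by rewrite andbT; apply/esym/negP=> /imsetP[z _ [xz yz]];
   rewrite xz yz eqxx in xy.
Qed.

Definition pairs_in_sum (T A : {set V}) : {set V * V} :=
  [set p in setX T T | p.1 + p.2 \in A].

(** [par] is the character cutting out the hyperplane.  Additivity of [par]
    forces the number of odd entries of a triple to be 0 or 2; in the second
    case, exactly one entry lies in [A].  The involutions
    [(x, y) |-> (x + y, y)] and [(x, y) |-> (x, x + y)] carry the triples whose
    entry in [A] is the first or the second summand to those whose entry in [A]
    is the sum. *)
Lemma rvalU_odd (par : V -> bool) (A T : {set V}) :
    {morph par : x y / x + y >-> x (+) y} ->
    {in A, forall x, ~~ par x} -> {in T, forall x, par x} ->
  rval (A :|: T) = (rval A + 3 * #|pairs_in_sum T A|)%N.
Proof.
move=> parD evA oddT.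
have inAT x : x \in A :|: T = if par x then x \in T else x \in A.
  rewrite inE; have [px|px] := ifPn.
    by case: (boolP (x \in A)) => // /evA; rewrite px.
  by case: (boolP (x \in T)) => [/oddT|]; [rewrite (negPf px) | rewrite orbF].
have inA x : x \in A -> par x = false by move/evA/negPf.
have inT x : x \in T -> par x = true by move/oddT.
rewrite /rval; set S := [set p in setX (A :|: T) _ | _].
rewrite -(cardsID [set p | par p.1] S) -(cardsID [set p | par p.2] (S :&: _)).
rewrite -(cardsID [set p | par p.2] (S :\: _)).
have inj1 : injective (fun p : V * V => (p.1 + p.2, p.2)).
  by move=> [x y] [x' y'] [+ yy]; rewrite /= yy => /addIr ->.
have inj2 : injective (fun p : V * V => (p.1, p.1 + p.2)).
  by move=> [x y] [x' y'] [xx] /=; rewrite xx => /addrI ->.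
have -> : S :&: [set p | par p.1] :&: [set p | par p.2] = pairs_in_sum T A.
  apply/setP=> -[x y]; rewrite !inE -!in_setU !inAT /= parD.
  case: (boolP (par x)) => px; case: (boolP (par y)) => py /=;
    rewrite ?andbT ?andbF //;
    by apply/esym/negP=> /andP[/andP[/inT xT /inT yT] _]; rewrite ?xT ?yT in px py.
have -> : #|(S :&: [set p | par p.1]) :\: [set p | par p.2]|
          = #|pairs_in_sum T A|.
  rewrite -[RHS](card_imset _ inj2); apply: eq_card => -[x z].
  apply/idP/imsetP => [|[[x' y] + [-> ->]]].
    rewrite !inE -!in_setU !inAT /= parD.
    move=> /andP[/negPf py /andP[+ px]]; rewrite px py /= => /andP[/andP[xT zA] xzT].
    by exists (x, x + z); rewrite /= ?addvK // !inE /= xT xzT addvK.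
  rewrite !inE -!in_setU !inAT /= !parD => /andP[/andP[x'T yT] xyA].
  by rewrite addvK !(inT _ x'T, inT _ yT) /= x'T yT xyA.
have -> : #|(S :\: [set p | par p.1]) :&: [set p | par p.2]|
          = #|pairs_in_sum T A|.
  rewrite -[RHS](card_imset _ inj1); apply: eq_card => -[z y].
  apply/idP/imsetP => [|[[x y'] + [-> ->]]].
    rewrite !inE -!in_setU !inAT /= parD.
    move=> /andP[/andP[/negPf px +] py]; rewrite px py /= => /andP[/andP[zA yT] zyT].
    by exists (z + y, y); rewrite /= -?addrA ?addvv ?addr0 // !inE /= zyT yT
         -addrA addvv addr0.
  rewrite !inE -!in_setU !inAT /= !parD => /andP[/andP[xT yT] xyA].
  by rewrite -addrA addvv addr0 !(inT _ xT, inT _ yT) /= xT yT xyA.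
have -> : (S :\: [set p | par p.1]) :\: [set p | par p.2]
          = [set p in setX A A | p.1 + p.2 \in A].
  apply/setP=> -[x y]; rewrite !inE -!in_setU !inAT /= parD.
  case: (boolP (par x)) => px; case: (boolP (par y)) => py //=;
    by apply/esym/negP=> /andP[/andP[/inA xA /inA yA] _]; rewrite ?xA ?yA in px py.
by rewrite [RHS]addnC !mulSn mul0n addn0 -!addnA.
Qed.

Definition plane (a b : V) : {set V} := [set 0; a; b; a + b].

Lemma mem_planeD (a b : V) :
  {in plane a b &, forall u v, u + v \in plane a b}.
Proof.
have planeDa u : u \in plane a b -> a + u \in plane a b.
  by rewrite !inE -!orbA => /or4P[] /eqP->;
     rewrite ?addvK ?addvv ?addr0 eqxx ?orbT.
have planeDb u : u \in plane a b -> b + u \in plane a b.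
  by rewrite !inE -!orbA => /or4P[] /eqP->;
     rewrite ?(addrC a b) ?addvK ?addvv ?addr0 eqxx ?orbT.
move=> u v uP vP.
have /or4P[] : [|| u == 0, u == a, u == b | u == a + b].
  by rewrite !inE -!orbA in uP.
all: move/eqP->; rewrite ?add0r -?addrA.
all: by do ?[exact: vP | apply: planeDa | apply: planeDb].
Qed.

Lemma card_plane (a b : V) : a != 0 -> b != 0 -> a != b -> #|plane a b| = 4.
Proof.
move=> a0 b0 ab; rewrite /plane -!setUA !cardsU1 cards1 !inE.
rewrite ![0 == _]eq_sym (negPf a0) (negPf b0) addv_eq0 (negPf ab).
by rewrite -[X in X == _ + _]addr0 (inj_eq (addrI a)) [0 == _]eq_sym (negPf b0)
     -[X in X == _ + _]add0r (inj_eq (addIr b)) [0 == _]eq_sym (negPf a0).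
Qed.

(** Sums of two points of the coset lie in [plane a b], which meets [A] in
    [{a, b}]: the neighbours of [u] in the coset are [u + a] and [u + b]. *)
Lemma card_coset_sums (A : {set V}) (e a b : V) :
    0 \notin A -> a \in A -> b \in A -> a != b -> a + b \notin A ->
  #|pairs_in_sum [set e + w | w in plane a b] A| = 8.
Proof.
move=> A0 aA bA ab abA; set T := [set e + w | w in _].
have nz x : x \in A -> x != 0 by apply: contraTneq => ->.
have memT x : (x \in T) = (e + x \in plane a b).
  apply/imsetP/idP => [[w wW ->]|exW]; first by rewrite addvK.
  by exists (e + x); rewrite ?addvK.
have cardT : #|T| = 4 by rewrite card_imset ?card_plane ?nz //; apply: addrI.
have inj : injective (fun p : V * V => (p.1, p.1 + p.2)).
  by move=> [x y] [x' y'] [xx] /=; rewrite xx => /addrI ->.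
(* A pair [(u, v)] is a point [u] with the direction [u + v] to its neighbour. *)
suff -> : pairs_in_sum T A
        = (fun p : V * V => (p.1, p.1 + p.2)) @: setX T [set a; b].
  by rewrite card_imset // cardsX cardT cards2 ab.
apply/setP=> -[u v]; apply/idP/imsetP => [|[[x d] + [-> ->]]].
  rewrite !inE /= => /andP[/andP[uT vT] uvA].
  exists (u, u + v); rewrite /= ?addvK // !inE uT /=.
  have : u + v \in plane a b.
    by rewrite -[u + v]add0r -(addvv e) addrACA mem_planeD // -memT.
  rewrite !inE (negPf (nz _ uvA)) /= => /orP[//|/eqP uv_ab].
  by rewrite uv_ab (negPf abA) in uvA.
rewrite !inE => /andP[/= xT dab]; rewrite addvK xT memT /= addrA.
rewrite mem_planeD -?memT //=; first by case/orP: dab => /eqP->.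
by rewrite !inE; case/orP: dab => ->; rewrite ?orbT.
Qed.

End ElementaryAbelian2.

Lemma F2_addbE (x y : 'F_2) : (x + y == 1) = (x == 1) (+) (y == 1).
Proof. by case: x y => [[|[|//]] ?] [[|[|//]] ?]. Qed.

Lemma F2_addxx (x : 'F_2) : x + x = 0.
Proof. by apply/eqP; case: x => [[|[|//]] ?]. Qed.

Theorem proposition4p10 (n : nat) (hn : (2 <= n)%N)
    (A : {set 'rV['F_2]_n}) (hA : A \subset F2n_pred n :\ 0)
    (k : nat) (hk : #|A| = k) (hk2 : (2 <= k)%N)
    (hr : rval A <> (k * (k - 1))%N) :
  exists B : {set 'rV['F_2]_n},
    [/\ B \subset [set: 'rV['F_2]_n] :\ 0, #|B| = (k + 4)%N & rval B = (rval A + 24)%N].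
Proof.
have addvv (x : 'rV['F_2]_n) : x + x = 0.
  by apply/rowP=> i; rewrite !mxE F2_addxx.
have A0 : 0 \notin A by apply/negP=> /(subsetP hA); rewrite !inE eqxx.
pose i0 : 'I_n := Ordinal (ltnW hn).
pose par (x : 'rV['F_2]_n) := x ord0 i0 == 1.
have parD : {morph par : x y / x + y >-> x (+) y}.
  by move=> x y; rewrite /par mxE F2_addbE.
have evA : {in A, forall x, ~~ par x}.
  move=> x /(subsetP hA); rewrite !inE => /andP[_ /forallP/(_ i0)].
  by rewrite /par => /eqP ->.
rewrite -hk in hr *.
have [a [b [aA bA ab abA]]] := rval_sum_notin _ addvv _ A0 hr.
pose e : 'rV['F_2]_n := delta_mx ord0 i0.
pose T := [set e + w | w in plane _ a b].
have oddT : {in T, forall x, par x}.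
  have pe : par e by rewrite /par mxE !eqxx.
  have p0 : par 0 = false by rewrite /par mxE.
  move=> _ /imsetP[w + ->]; rewrite parD pe !inE -!orbA.
  by case/or4P=> /eqP->; rewrite ?parD ?p0 ?(negPf (evA _ aA)) ?(negPf (evA _ bA)).
exists (A :|: T); split.
- apply/subsetP=> x; rewrite !inE andbT; apply: contraTneq => ->.
  by rewrite (negPf A0) /=; apply/negP=> /oddT; rewrite /par mxE.
- have nz x : x \in A -> x != 0 by apply: contraTneq => ->.
  have AT0 : A :&: T = set0.
    apply/setP=> x; rewrite !inE; apply/negP=> /andP[/evA px /oddT].
    exact/negP.
  rewrite cardsU AT0 cards0 subn0 card_imset; last exact: addrI.
  by rewrite card_plane ?nz.
- by rewrite (rvalU_odd _ addvv _ _ _ parD) // card_coset_sums.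
Qed.
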